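(* Let $s,k,n$ be positive integers with $0<s<k\leq n$. Let $L=\{1,2,\ldots,s\}$. Suppose that $n>\binom{k^2}{2}s$. Let $\mathcal{F}=\{F_1,\ldots,F_m\}$ be an $L$-intersecting, $k$-uniform family of $m$ subsets of $[n]$. Then $$ m\leq \binom{n-1}{s}. $$ Further, if $n>\binom{k^2}{2}s+1$ and $$ |\mathcal{F}|=\binom{n-1}{s}, $$ then $\bigcap_{F\in\mathcal{F}}F\neq\emptyset$.
   Context: $[n]=\{1,2,\ldots,n\}$. A family $\mathcal{F}$ is a set of (distinct) subsets of $[n]$, so $m=|\mathcal{F}|$. A family $\mathcal{F}$ is $k$-uniform if $|F|=k$ for each $F\in\mathcal{F}$. For a set $L$ of nonnegative integers, a family $\mathcal{F}$ is $L$-intersecting if $|E\cap F|\in L$ for every pair $E,F$ of distinct members of $\mathcal{F}$. *)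

(* Defs.v *)
(* The ground set {1, ..., n} is represented by 'I_n, and a
   family (a set of distinct subsets) by an element of {set {set 'I_n}}. *)
From mathcomp Require Import all_boot.

Set Implicit Arguments.
Unset Strict Implicit.
Unset Printing Implicit Defensive.

Definition uniform_family (T : finType) (k : nat) (F : {set {set T}}) : Prop :=
  forall A : {set T}, A \in F -> #|A| = k.

Definition intersecting_family (T : finType) (L : {pred nat})
    (F : {set {set T}}) : Prop :=
  forall A B : {set T}, A \in F -> B \in F -> A != B -> #|A :&: B| \in L.

(* Main.v *)
Require Import Defs.
From mathcomp Require Import all_boot.
From mathcomp Require Import zify.

Set Implicit Arguments.
Unset Strict Implicit.
Unset Printing Implicit Defensive.

(** Two distinct members share at most [s] points, so a set of [s + 1] points
    lies in at most one member.  Hence, for a set [S] of at most [s + 1] points,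
    a member containing [S] is determined by any [s + 1 - #|S|] further points
    of it, and at most ['C(n - #|S|, s + 1 - #|S|)] members contain [S]
    ([card_link_le]).

    If all members share a point [x], then [S = [set x]] gives the bound
    ['C(n - 1, s)].

    If no point is common to all members, fix a member [A].  Every member meets
    [A] in some [x]; some member [B] avoids [x], and every member through [x]
    meets [B] in some [y != x].  So the family is covered by at most [k ^ 2]
    sets of members through two given points, each of size at most
    ['C(n - 2, s - 1)] ([card_no_common_point]).  Since
    [s * 'C(n - 1, s) = (n - 1) * 'C(n - 2, s - 1)] and
    [k ^ 2 * s < 'C(k ^ 2, 2) * s <= n - 1], this is strictly less than
    ['C(n - 1, s)], so the extremal families have a common point. *)

Section FamiliesOfSets.

Variable T : finType.
Implicit Types (F : {set {set T}}) (A B S : {set T}).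

(** Sending a member [A] above [S] to some [s + 1 - #|S|] points of [A :\: S] is
    injective: two distinct members with the same image [R] would share the
    [s + 1] points of [S :|: R]. *)
Lemma card_link_le (s : nat) F S :
  {in F, forall A, s < #|A|} ->
  {in F &, forall A B, A != B -> #|A :&: B| <= s} ->
  #|S| <= s.+1 ->
  #|[set A in F | S \subset A]| <= 'C(#|T| - #|S|, s.+1 - #|S|).
Proof.
move=> F_large F_meet S_small; set m := s.+1 - #|S|.
pose f A := odflt set0 [pick R : {set T} | R \subset A :\: S & #|R| == m].
have fP A : A \in F -> S \subset A -> f A \subset A :\: S /\ #|f A| = m.
  move=> AF SA; rewrite /f; case: pickP => [R /andP[RA /eqP] //|no_R].
  (* The large members have enough points outside S for a choice to exist. *)
  have : 0 < #|[set R : {set T} | R \subset A :\: S & #|R| == m]|.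
    rewrite cards_draws bin_gt0 cardsD (setIidPr SA).
    by rewrite leq_sub2r // F_large.
  by case/card_gt0P=> R; rewrite inE no_R.
have f_inj : {in [set A in F | S \subset A] &, injective f}.
  move=> A B; rewrite !inE => /andP[AF SA] /andP[BF SB] fAB.
  have [fA card_fA] := fP A AF SA; have [fB _] := fP B BF SB.
  rewrite -fAB in fB; apply/eqP; apply: contraT => neqAB.
  have := F_meet A B AF BF neqAB; rewrite leqNgt => /negP[].
  have [fA' disj_fA] : f A \subset A /\ [disjoint f A & S].
    by move: fA; rewrite subsetD => /andP[].
  have fB' : f A \subset B by move: fB; rewrite subsetD => /andP[].
  suff <- : #|S :|: f A| = s.+1.
    by apply: subset_leq_card; rewrite subsetI !subUset SA SB fA' fB'.
  rewrite cardsU disjoint_setI0 1?disjoint_sym // cards0 subn0 card_fA.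
  by rewrite subnKC.
rewrite -(card_in_imset f_inj).
have <- : #|~: S| = #|T| - #|S| by rewrite -(cardsC S) addKn.
rewrite -cards_draws.
apply: subset_leq_card; apply/subsetP=> _ /imsetP[A /[!inE] /andP[AF SA] ->].
have [fA ->] := fP A AF SA; rewrite eqxx andbT.
by apply: subset_trans fA _; rewrite setDE subsetIr.
Qed.

Lemma card_le_sum_degree F B :
  {in F, forall A, A :&: B != set0} ->
  #|F| <= \sum_(y in B) #|[set A in F | y \in A]|.
Proof.
move=> F_meets; rewrite -sum1_card.
under [leqRHS]eq_bigr => y _ do rewrite -sum1dep_card big_mkcondr /=.
rewrite exchange_big /=; apply: leq_sum => A AF.
have /set0Pn[y /setIP[yA yB]] := F_meets A AF.
by rewrite (bigD1 y) //= yA.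
Qed.

(** The absence of a common point is used for the second point [y] of the cover:
    a member avoiding [x] is needed to conclude [y != x]. *)
Lemma card_no_common_point (s k : nat) F :
  0 < s -> s < k -> uniform_family k F ->
  intersecting_family [pred l : nat | 1 <= l <= s] F ->
  \bigcap_(A in F) A = set0 ->
  #|F| <= k ^ 2 * 'C(#|T| - 2, s - 1).
Proof.
move=> s_gt0 s_lt_k F_unif F_int F_cap.
have F_large : {in F, forall A, s < #|A|} by move=> A /F_unif ->.
have F_le : {in F &, forall A B, A != B -> #|A :&: B| <= s}.
  by move=> A B AF BF /(F_int A B AF BF) /andP[].
have F_meet : {in F &, forall A B, A :&: B != set0}.
  move=> A B AF BF; rewrite -card_gt0; have [<-|] := eqVneq A B.
    by rewrite setIid (leq_ltn_trans _ (F_large A AF)).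
  by move=> /(F_int A B AF BF) /andP[].
have card_pair x y : x != y ->
    #|[set A in [set A in F | x \in A] | y \in A]| <= 'C(#|T| - 2, s - 1).
  move=> neq_xy; have card_xy : #|[set x; y]| = 2 by rewrite cards2 neq_xy.
  have := card_link_le (S := [set x; y]) F_large F_le.
  rewrite card_xy subSS => /(_ s_gt0); apply: leq_trans.
  apply/subset_leq_card/subsetP=> A.
  by rewrite !inE subUset !sub1set -andbA.
have card_point x : #|[set A in F | x \in A]| <= k * 'C(#|T| - 2, s - 1).
  have [B BF xB] : exists2 B, B \in F & x \notin B.
    apply/exists_inP; rewrite -negb_forall_in; apply/negP => /forall_inP x_all.
    have : x \in \bigcap_(A in F) A by apply/bigcapP.
    by rewrite F_cap inE.
  rewrite -(F_unif B BF) -sum_nat_const.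
  apply: leq_trans (card_le_sum_degree (B := B) _) _ => [A|].
    by rewrite inE => /andP[AF _]; apply: F_meet.
  apply: leq_sum => y yB; apply: card_pair.
  by apply: contraNneq xB => ->.
have [->|[A AF]] := set_0Vmem F; first by rewrite cards0.
rewrite -mulnn -mulnA -{1}(F_unif A AF) -sum_nat_const.
apply: leq_trans (card_le_sum_degree (B := A) _) _ => [B BF|].
  exact: F_meet.
exact: leq_sum.
Qed.

End FamiliesOfSets.

(** After multiplying by [s], both sides are multiples of ['C(n - 2, s - 1)], and
    [k >= 2] makes ['C(k ^ 2, 2)] exceed [k ^ 2]. *)
Lemma sqr_mul_bin_lt (s k n : nat) :
  0 < s -> s < k -> k <= n -> 'C(k ^ 2, 2) * s < n ->
  k ^ 2 * 'C(n - 2, s - 1) < 'C(n - 1, s).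
Proof.
move=> s_gt0 s_lt_k k_le_n n_large.
have k2_lt : k ^ 2 < 'C(k ^ 2, 2).
  have k2_ge4 : 4 <= k ^ 2 by rewrite -mulnn; nia.
  have := mul_bin_diag (k ^ 2) 1; rewrite bin1; nia.
have bin_pos : 0 < 'C(n - 2, s - 1) by rewrite bin_gt0; lia.
have := mul_bin_diag (n - 1) (s - 1).
have -> : (n - 1).-1 = n - 2 by lia.
have -> : (s - 1).+1 = s by lia.
move=> bin_rec; rewrite -(ltn_pmul2l s_gt0) -bin_rec mulnA ltn_pmul2r //.
by nia.
Qed.

Theorem corollary1p12 (s k n : nat) (F : {set {set 'I_n}})
    (hs : 0 < s) (hsk : s < k) (hkn : k <= n)
    (hn : 'C(k ^ 2, 2) * s < n)
    (hL : intersecting_family [pred l : nat | 1 <= l <= s] F)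
    (hk : uniform_family k F) :
  #|F| <= 'C(n - 1, s) /\
  ('C(k ^ 2, 2) * s + 1 < n ->
   #|F| = 'C(n - 1, s) ->
   \bigcap_(A in F) A != set0).
Proof.
have no_common : \bigcap_(A in F) A = set0 -> #|F| < 'C(n - 1, s).
  move=> /(card_no_common_point hs hsk hk hL); rewrite card_ord => F_le.
  exact: leq_ltn_trans F_le (sqr_mul_bin_lt hs hsk hkn hn).
split=> [|_ F_eq]; last first.
  by apply/eqP => /no_common; rewrite F_eq ltnn.
have [/no_common /ltnW //|[x /bigcapP x_common]] :=
  set_0Vmem (\bigcap_(A in F) A).
have := @card_link_le _ s F [set x].
rewrite cards1 card_ord subSS subn0 => F_link.
apply: leq_trans (F_link _ _ isT) => [|A /hk -> //|A B AF BF neqAB].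
  apply/subset_leq_card/subsetP=> A AF.
  by rewrite inE AF sub1set x_common.
by case/andP: (hL A B AF BF neqAB).
Qed.
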